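(* Let $n\ge 1$, let $a=(a_1,\ldots,a_n)$ and $b=(b_1,\ldots,b_n)$ be two $n$-tuples of positive integers, and let $X\subseteq\mathbb{N}$. Then the family $\mathcal{N}(a,b,X)$ is a Frobenius variety.
   Context: $\mathbb{N}$ is the set of non-negative integers. A numerical semigroup is a submonoid $S$ of $(\mathbb{N},+)$ such that $\mathbb{N}\setminus S$ is finite. The Frobenius number $\mathrm{F}(S)$ of a numerical semigroup $S$ is the maximum integer that does not belong to $S$. For $n$-tuples $a,b$ of positive integers and $s\in\mathbb{N}$, $as+b=(a_1s+b_1,\ldots,a_ns+b_n)$. $\mathcal{N}(a,b,X)$ is the set of all numerical semigroups $S$ such that $X\subseteq S$ and $as+b\in S^n$ for all $s\in S\setminus\{0\}$. A Frobenius variety is a non-empty family $\mathcal{V}$ of numerical semigroups such that: (V1) if $S,T\in\mathcal{V}$, then $S\cap T\in\mathcal{V}$; (V2) if $S\in\mathcal{V}$ and $S\neq\mathbb{N}$, then $S\cup\{\mathrm{F}(S)\}\in\mathcal{V}$. *)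

(* Defs.v *)
From mathcomp Require Import all_boot all_order all_algebra.
From mathcomp Require Import mathcomp_extra boolp classical_sets functions cardinality.

Set Implicit Arguments.
Unset Strict Implicit.
Unset Printing Implicit Defensive.

Import Order.TTheory GRing.Theory Num.Theory.
Local Open Scope classical_set_scope.
Local Open Scope nat_scope.

Definition submonoid (S : set nat) : Prop :=
  S 0 /\ (forall x y, S x -> S y -> S (x + y)).

Definition numerical_semigroup (S : set nat) : Prop :=
  submonoid S /\ finite_set (~` S).

(* The maximum is taken over the integers, not the naturals: F(nat) = -1. *)
Definition int_gaps (S : set nat) : set int := ~` (Posz @` S).

(* xget returns the maximum of int_gaps S, or the dummy value 0 if there is
   none; frobenius_numberP shows that it exists for a numerical semigroup. *)
Definition frobenius_number (S : set nat) : int :=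
  xget 0%R (int_gaps S `&` ubound (int_gaps S)).

Lemma frobenius_numberP (S : set nat) : numerical_semigroup S ->
  int_gaps S (frobenius_number S) /\ ubound (int_gaps S) (frobenius_number S).
Proof.
move=> [_ finC]; suff [f Hf] : exists f, (int_gaps S `&` ubound (int_gaps S)) f.
  exact: (xgetPex 0%R (ex_intro _ f Hf)).
have [[k0 Hk0]|noC] := pselect (exists k, ~ S k); last first.
  exists (- 1)%R; split=> [[k _]//|[k|k] // Hk].
  by case: noC; exists k => Sk; apply: Hk; exists k.
have /finite_seqP[s Es] := finC.
have sP k : ~ S k <-> k \in s by move: (congr1 (fun A : set nat => A k) Es) => /= <-.
have bound k : k \in s -> k <= \max_(i <- s) i.
  by move=> ks; apply: (@leq_bigmax_seq _ _ xpredT id).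
have Hex : exists k, k \in s by exists k0; apply/sP.
exists (Posz (ex_maxn Hex bound)); case: ex_maxnP => m ms mmax; split.
  by move=> [k Sk [km]]; move/sP: ms; rewrite -km.
move=> [k|k] // Hk; rewrite lez_nat; apply/mmax/sP => Sk.
by apply: Hk; exists k.
Qed.

(* When S <> setT the Frobenius number is a natural number, and the second
   component below is the singleton {F(S)}. *)
Definition adjoin_frobenius (S : set nat) : set nat :=
  S `|` [set k | Posz k = frobenius_number S].

Definition frobenius_variety (V : set (set nat)) : Prop :=
  [/\ V !=set0,
      V `<=` numerical_semigroup,
      (forall S T, V S -> V T -> V (S `&` T)) &
      (forall S, V S -> S <> setT -> V (adjoin_frobenius S))].

Definition affine_tuple n (a b : n.-tuple nat) (s : nat) : n.-tuple nat :=
  [tuple tnth a i * s + tnth b i | i < n].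

Definition semigroup_family n (a b : n.-tuple nat) (X : set nat) :
    set (set nat) :=
  [set S | [/\ numerical_semigroup S,
               X `<=` S &
               forall s, S s -> s <> 0 ->
                 forall i : 'I_n, S (tnth (affine_tuple a b s) i)]].

(* Main.v *)
Require Import Defs.
From mathcomp Require Import all_boot all_order all_algebra.
From mathcomp Require Import mathcomp_extra boolp classical_sets functions cardinality.

(** Everything above the Frobenius number [m] of [S] lies in [S]; the sums
[m + x] with [0 < x] and the values [a_i * m + b_i] are all above [m]. *)

Local Open Scope classical_set_scope.

(** The conditions defining the family are satisfied by [setT] and pass to intersections, so only
    adjoining the Frobenius number [m] takes work. The only new inputs to addition and to the maps
    [a_i * s + b_i] are those involving [m]; their outputs are [m] itself or exceed [m], and every
    number above [m] is already in [S]. The lemmas carrying this are [frobenius_number_nat] and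
    [numerical_semigroup_setU1]. *)

Lemma numerical_semigroupT : numerical_semigroup setT.
Proof. by split=> //; rewrite setCT; exact: finite_set0. Qed.

Lemma numerical_semigroupI (S T : set nat) :
  numerical_semigroup S -> numerical_semigroup T ->
  numerical_semigroup (S `&` T).
Proof.
move=> [[S0 SD] finS] [[T0 TD] finT]; split; last first.
  by rewrite setCI finite_setU.
by split=> // x y [Sx Tx] [Sy Ty]; split; [exact: SD | exact: TD].
Qed.

(** A natural gap of [S] is also an integer gap, hence bounded by the Frobenius number; this rules
    out a negative value. *)
Lemma frobenius_number_nat (S : set nat) :
  numerical_semigroup S -> S <> setT ->
  exists m : nat, [/\ frobenius_number S = Posz m, ~ S m &
                      forall k, (m < k)%N -> S k].
Proof.
move=> nsS ST; have [gapF ubF] := frobenius_numberP nsS.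
have ubgap k : ~ S k -> (Posz k <= frobenius_number S)%R.
  by move=> Sk; apply: ubF => -[j Sj [jk]]; apply: Sk; rewrite -jk.
have [k Sk] : exists k, ~ S k.
  by apply/existsNP => allS; apply: ST; apply/seteqP; split.
case: (frobenius_number S) gapF ubgap => [m|m] gapF ubgap; last first.
  by have := ubgap _ Sk.
exists m; split=> // [Sm|j mj]; first by apply: gapF; exists m.
by apply: contrapT => /ubgap; rewrite lez_nat leqNgt mj.
Qed.

Lemma numerical_semigroup_setU1 (S : set nat) (m : nat) :
  numerical_semigroup S -> ~ S m -> (forall k, (m < k)%N -> S k) ->
  numerical_semigroup (S `|` [set m]).
Proof.
(* Since 0 is in [S], the gap [m] is positive, whence [m + m] exceeds [m]. *)
move=> [[S0 SD] finS] Sm Sgt; have m_gt0 : (0 < m)%N.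
  by case: m Sm {Sgt}.
have SmD x : S x -> (S `|` [set m]) (m + x)%N.
  move=> Sx; have [->|x_gt0] := posnP x; first by rewrite addn0; right.
  by left; apply: Sgt; rewrite -addn1 leq_add2l.
split; last by rewrite setCU; exact: finite_setIl.
split=> [|x y]; first by left.
move=> [Sx|->] [Sy|->]; [by left; exact: SD | by rewrite addnC; exact: SmD |
  exact: SmD | by left; apply: Sgt; rewrite -addn1 leq_add2l].
Qed.

Theorem proposition2p1 (n : nat) (hn : (0 < n)%N) (a b : n.-tuple nat)
  (ha : forall i : 'I_n, (0 < tnth a i)%N)
  (hb : forall i : 'I_n, (0 < tnth b i)%N)
  (X : set nat) :
  frobenius_variety (semigroup_family a b X).
Proof.
split.
- by exists setT; split=> //; exact: numerical_semigroupT.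
- by move=> S [].
- move=> S T [nsS XS affS] [nsT XT affT]; split.
  + exact: numerical_semigroupI.
  + by move=> x Xx; split; [exact: XS | exact: XT].
  + by move=> s [Ss Ts] s0 i; split; [exact: affS | exact: affT].
- move=> S [nsS XS affS] ST.
  have [m [Fm Sm Sgt]] := frobenius_number_nat S nsS ST.
  have -> : adjoin_frobenius S = S `|` [set m].
    by rewrite /adjoin_frobenius Fm; congr (_ `|` _); apply/seteqP;
      split=> k /= => [[]|->].
  split.
  + exact: numerical_semigroup_setU1.
  + by move=> x /XS; left.
  (* Even for [s = m] the value lands in [S] itself: [m <= a_i * m] and [1 <= b_i] give
     [m < a_i * m + b_i]. *)
  + move=> s [Ss|->] s0 i; left; first exact: affS.
    apply: Sgt; rewrite tnth_mktuple.
    by rewrite -[X in (X < _)%N]addn0 -addnS leq_add // leq_pmull.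
Qed.
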